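(* Let $\bar x\in\mathcal F$ be a feasible point of the problem $(P)$: minimize $f(x)$ over $x\in C$ subject to $G(x)\in K$. Then the following statements hold: (a) Suppose that $f'\colon X\to X^*$ is weak-to-weak* sequentially continuous. If $\bar x$ is a w-AKKT point of $(P)$ and $\bar x$ is w-AKKT regular, then $\bar x$ is a KKT point of $(P)$. (b) Conversely, if for every continuously differentiable function $f\colon X\to\mathbb R$ the implication ''$\bar x$ is a w-AKKT point of $(P)$ $\Longrightarrow$ $\bar x$ is a KKT point of $(P)$'' holds (with $C$, $K$, $G$ fixed and $f$ as the objective), then $\bar x$ is w-AKKT regular.
   Context: Setting: $X$ and $Y$ are real Banach spaces, $f\colon X\to\mathbb R$ and $G\colon X\to Y$ are continuously Fréchet differentiable, $C\subset X$ and $K\subset Y$ are nonempty, closed, convex sets. Problem $(P)$: minimize $f(x)$ over $x\in C$ subject to $G(x)\in K$; its feasible set is $\mathcal F:=\{x\in C\mid G(x)\in K\}$. The symbols $\rightharpoonup$ and $\rightharpoonup^*$ denote weak and weak* convergence of sequences. The map $f'\colon X\to X^*$ is weak-to-weak* sequentially continuous if $x^k\rightharpoonup x$ implies $f'(x^k)\rightharpoonup^* f'(x)$. For a closed convex set $S$, $\mathcal N_S(x):=\{v\mid \langle v,z-x\rangle\le 0\ \forall z\in S\}$ (a subset of the dual space) for $x\in S$ and $\mathcal N_S(x):=\varnothing$ for $x\notin S$. The Lagrangian is $L(x,\lambda):=f(x)+\langle\lambda,G(x)\rangle_Y$ for $x\in X$, $\lambda\in Y^*$. A point $\bar x\in\mathcal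 F$ is a KKT point of $(P)$ if there is $\bar\lambda\in Y^*$ with $-L'_x(\bar x,\bar\lambda)\in\mathcal N_C(\bar x)$ and $\bar\lambda\in\mathcal N_K(G(\bar x))$. A point $\bar x\in\mathcal F$ is a w-AKKT point of $(P)$ if there are sequences $\{(x^k,\lambda^k)\}\subset C\times Y^*$, $\{\varepsilon^k\}\subset X^*$, $\{r^k\}\subset[0,+\infty)$ with $x^k\rightharpoonup\bar x$, $\varepsilon^k\rightharpoonup^*0$, $r^k\to0$ such that for all $k$: $\varepsilon^k-L'_x(x^k,\lambda^k)\in\mathcal N_C(x^k)$ and $\langle\lambda^k,y-G(x^k)\rangle_Y\le r^k$ for all $y\in K$. For $x\in X$ and $r\ge0$ let $$\mathcal M(x,r):=\{G'(x)^*\lambda+\mu\in X^*\mid \lambda\in Y^*,\ \mu\in\mathcal N_C(x),\ \langle\lambda,y-G(x)\rangle_Y\le r\ \forall y\in K\}.$$ A point $\bar x\in\mathcal F$ is w-AKKT regular if every $\bar v\in X^*$ for which there exist $\{x^k\}\subset X$, $\{r^k\}\subset[0,+\infty)$, $\{v^k\}\subset X^*$ with $x^k\rightharpoonup\bar x$, $r^k\to0$, $v^k\rightharpoonup^*\bar v$ and $v^k\in\mathcal M(x^k,r^k)$ for all $k$ belongs to $\mathcal M(\bar x,0)$. *)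

(* Defs.v *)
From mathcomp Require Import all_boot all_order all_algebra.
From mathcomp Require Import all_classical all_reals all_analysis.

Set Implicit Arguments.
Unset Strict Implicit.
Unset Printing Implicit Defensive.
Import Order.TTheory GRing.Theory Num.Theory.
Import numFieldNormedType.Exports.

Local Open Scope classical_set_scope.
Local Open Scope ring_scope.

Section Duality.
Context {R : realType} {V W : normedModType R}.

(* The dual V^* is a set of functions V -> R; the pairing <v, x> is the
   application v x, and the vector operations are the pointwise ones. *)
Definition dual_space : set (V -> R) :=
  [set v | linear (v : V -> R^o) /\ continuous v].

Definition weak_cvg (x : nat -> V) (l : V) : Prop :=
  forall v, dual_space v -> v (x k) @[k --> \oo] --> v l.

Definition weak_star_cvg (v : nat -> V -> R) (l : V -> R) : Prop :=
  forall h : V, v k h @[k --> \oo] --> l h.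

(* Meaningful for continuous linear T, for which the set is bounded above. *)
Definition operator_norm (T : V -> W) : R :=
  sup [set `|T h| | h in [set h : V | `|h| <= 1]].

Definition continuously_differentiable (F : V -> W) : Prop :=
  (forall x, differentiable F x) /\
  (forall x, operator_norm ('d F y \- 'd F x) @[y --> x] --> (0 : R)).

Definition normal_cone (S : set V) (x : V) : set (V -> R) :=
  [set v | [/\ dual_space v, S x & forall z, S z -> v (z - x) <= 0]].

End Duality.

Section Problem.
Context {R : realType} {X Y : normedModType R}.
Variables (C : set X) (K : set Y) (G : X -> Y).

Definition feasible_set : set X := [set x | C x /\ K (G x)].

Definition lagrangian (f : X -> R) (x : X) (lambda : Y -> R) : R :=
  f x + lambda (G x).

Definition lagrangian_dx (f : X -> R) (x : X) (lambda : Y -> R) : X -> R :=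
  'd (fun z => lagrangian f z lambda) x.

Definition KKT_point (f : X -> R) (xbar : X) : Prop :=
  feasible_set xbar /\
  exists lambda : Y -> R,
    [/\ dual_space lambda,
        normal_cone C xbar (\- lagrangian_dx f xbar lambda) &
        normal_cone K (G xbar) lambda].

Definition wAKKT_point (f : X -> R) (xbar : X) : Prop :=
  feasible_set xbar /\
  exists (x : nat -> X) (lambda : nat -> Y -> R) (eps : nat -> X -> R)
         (r : nat -> R),
    [/\ forall k, [/\ C (x k), dual_space (lambda k), dual_space (eps k)
                    & 0 <= r k],
        weak_cvg x xbar,
        weak_star_cvg eps (fun=> 0),
        r k @[k --> \oo] --> (0 : R) &
        forall k,
          normal_cone C (x k) (eps k \- lagrangian_dx f (x k) (lambda k)) /\
          (forall y, K y -> lambda k (y - G (x k)) <= r k)].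

(* The adjoint G'(x)^* lambda is the composition of lambda with 'd G x. *)
Definition AKKT_cone (x : X) (r : R) : set (X -> R) :=
  [set v | exists (lambda : Y -> R) (mu : X -> R),
    [/\ dual_space lambda, normal_cone C x mu,
        forall y, K y -> lambda (y - G x) <= r &
        v = (lambda \o 'd G x) \+ mu]].

Definition wAKKT_regular (xbar : X) : Prop :=
  feasible_set xbar /\
  forall vbar : X -> R, dual_space vbar ->
    (exists (x : nat -> X) (r : nat -> R) (v : nat -> X -> R),
      [/\ forall k, 0 <= r k /\ dual_space (v k),
          weak_cvg x xbar,
          r k @[k --> \oo] --> (0 : R),
          weak_star_cvg v vbar &
          forall k, AKKT_cone (x k) (r k) (v k)]) ->
    AKKT_cone xbar 0 vbar.

End Problem.

Definition weak_to_weak_star_continuous_derivative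
    {R : realType} {X : normedModType R} (f : X -> R) : Prop :=
  forall (x : nat -> X) (l : X),
    weak_cvg x l -> weak_star_cvg (fun k => 'd f (x k) : X -> R) ('d f l).

(* Main.v *)
From HB Require Import structures.
Require Import Defs.
From mathcomp Require Import all_boot all_order all_algebra.
From mathcomp Require Import all_classical all_reals all_analysis.
Import Order.TTheory GRing.Theory Num.Theory.
Import numFieldNormedType.Exports.
Local Open Scope classical_set_scope.
Local Open Scope ring_scope.

(* The limits [v] of the sets M(x, r) are tested against the linear objective
   [-v]: its Lagrangian derivative at (x, lambda) is G'(x)^* lambda - v, so
   sequences in M(x^k, r^k) converging weakly* to [v] are exactly w-AKKT
   sequences for [-v], with eps^k = v^k - v, and the KKT condition for [-v]
   says that [v] lies in M(xbar, 0).  Conversely a w-AKKT sequence for f gives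
   v^k = eps^k - f'(x^k) in M(x^k, r^k), which converges weakly* to -f'(xbar). *)

Section DualSpace.
Context {R : realType} {V : normedModType R}.
Implicit Types u v : V -> R.

Lemma dual_spaceD u v : dual_space u -> dual_space v -> dual_space (u \+ v).
Proof.
move=> [lu cu] [lv cv]; split; last by move=> x; apply: cvgD; [exact: cu | exact: cv].
by move=> a x y; rewrite /= lu lv scalerDr addrACA.
Qed.

Lemma dual_spaceN v : dual_space v -> dual_space (\- v).
Proof.
move=> [lv cv]; split; last by move=> x; apply: cvgN; exact: cv.
by move=> a x y; rewrite /= lv opprD scalerN.
Qed.

Lemma dual_spaceB u v : dual_space u -> dual_space v -> dual_space (u \- v).
Proof. by move=> du dv; exact/dual_spaceD/dual_spaceN. Qed.

Lemma dual_space_diff (f : V -> R) x :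
  differentiable f x -> dual_space ('d f x).
Proof. by move=> df; split; [exact: linearP | exact: diff_continuous]. Qed.

(** A continuous linear map is its own derivative at every point. Since [v] is a bare function, it
    is first packed with its linearity proof into a bundled linear map [L]. *)
Lemma dual_space_is_diff v x : dual_space v -> is_diff x v v.
Proof.
move=> [lv cv].
pose M := GRing.isLinear.Build R V R^o _ v lv.
pose L : {linear V -> R^o} := HB.pack v M.
apply: DiffDef; first exact: (@linear_differentiable _ _ _ L _ (cv : continuous L)).
exact: (@diff_lin _ _ _ L _ (cv : continuous L)).
Qed.

Lemma operator_norm0 : operator_norm (fun _ : V => 0 : R) = 0.
Proof.
rewrite /operator_norm (_ : [set _ | _ in _] = [set 0]) ?sup1//.
apply/seteqP; split=> [_ [h _ <-]|_ ->] /=; first by rewrite normr0.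
by exists 0; rewrite /= ?normr0.
Qed.

(** The derivative is [v] at every point, so the differences of derivatives are the zero map, of
    operator norm 0. *)
Lemma dual_space_continuously_differentiable v :
  dual_space v -> continuously_differentiable v.
Proof.
move=> dv; split=> x; first by have [] := dual_space_is_diff v x dv.
under eq_fun => y.
  rewrite (_ : _ \- _ = fun=> 0) ?operator_norm0; first over.
  apply/funext => h /=.
  have [_ ->] := dual_space_is_diff v y dv.
  by have [_ ->] := dual_space_is_diff v x dv; rewrite subrr.
exact: cvg_cst.
Qed.

End DualSpace.

Lemma lagrangian_dxE (R : realType) (X Y : normedModType R) (G : X -> Y)
    (f : X -> R) (x : X) (lambda : Y -> R) :
  differentiable f x -> differentiable G x -> dual_space lambda ->
  lagrangian_dx G f x lambda = 'd f x \+ (lambda \o 'd G x).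
Proof.
move=> df dG dl; have [dlG lE] := dual_space_is_diff lambda (G x) dl.
rewrite /lagrangian_dx /lagrangian.
rewrite (@diffD _ _ _ f (lambda \o G))//; last exact: differentiable_comp.
by apply/funext => h /=; rewrite (@diff_comp _ _ _ _ G lambda)//= lE.
Qed.

Theorem theorem4p7 (R : realType) (X Y : completeNormedModType R)
    (f : X -> R) (G : X -> Y) (C : set X) (K : set Y) (xbar : X)
    (hf : continuously_differentiable f)
    (hG : continuously_differentiable G)
    (C_nonempty : C !=set0) (C_closed : closed C)
    (C_convex : convex_set (C : set (convex_lmodType X)))
    (K_nonempty : K !=set0) (K_closed : closed K)
    (K_convex : convex_set (K : set (convex_lmodType Y)))
    (hxbar : feasible_set C K G xbar) :
  (weak_to_weak_star_continuous_derivative f ->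
   wAKKT_point C K G f xbar -> wAKKT_regular C K G xbar ->
   KKT_point C K G f xbar) /\
  ((forall g : X -> R, continuously_differentiable g ->
      wAKKT_point C K G g xbar -> KKT_point C K G g xbar) ->
   wAKKT_regular C K G xbar).
Proof.
have [df _] := hf; have [dG _] := hG; have [_ KG] := hxbar.
split=> [wf [_ [x [l [eps [r [H xcvg ecvg rcvg N]]]]]] [_ reg]|kkt].
  have [] := reg (\- 'd f xbar); first exact/dual_spaceN/dual_space_diff.
    exists x, r, (fun k => eps k \- 'd f (x k)); split=> // [k|h|k].
    - have [_ _ de r0] := H k.
      by split=> //; exact/dual_spaceB/dual_space_diff.
    - rewrite -[X in _ --> X]add0r.
      by apply: (@cvgB _ R^o); [exact: ecvg | exact: wf].
    - have [_ dl _ _] := H k; have [nC nK] := N k.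
      (* The normal vector is the one from the w-AKKT condition; adding G'(x^k)^* l^k to it cancels
         the constraint term of the Lagrangian derivative. *)
      exists (l k), (eps k \- lagrangian_dx G f (x k) (l k)); split=> //.
      rewrite lagrangian_dxE//; apply/funext => h /=.
      by rewrite [RHS]addrC opprD addrA subrK.
  (* With r = 0 the bound on [lambda], together with [KG], is membership in the normal cone of [K];
     [E] identifies the negated Lagrangian derivative with [mu]. *)
  move=> lambda [mu [dl nC nK E]]; split=> //; exists lambda; split=> //.
  rewrite lagrangian_dxE// (_ : \- _ = mu)//; apply/funext => h /=.
  by have /= := congr1 (@^~ h) E; rewrite opprD => ->; rewrite addrC addKr.
split=> // v dv [x [r [w [H xcvg rcvg wcvg M]]]].
have dvE y := dual_space_is_diff _ y (dual_spaceN _ dv).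
have LE y l : dual_space l ->
    lagrangian_dx G (\- v) y l = \- v \+ (l \o 'd G y).
  by move=> dl; have [dy vE] := dvE y; rewrite lagrangian_dxE// vE.
have [] := kkt (\- v).
- exact/dual_space_continuously_differentiable/dual_spaceN.
- split=> //; have [l Hl] := choice M; have [mu Hmu] := choice Hl.
  exists x, l, (fun k => w k \- v), r; split=> // [k|h|k].
  (* Regularity takes x^k from the whole space; that x^k lies in [C] follows because the normal cone
     containing [mu k] would otherwise be empty. *)
  + have [dl [_ Cx _] _ _] := Hmu k; have [r0 dw] := H k.
    by split=> //; exact: dual_spaceB.
  + rewrite -[X in _ --> X](subrr (v h)).
    by apply: (@cvgB _ R^o); [exact: wcvg | exact: cvg_cst].
  + have [dl nC nK E] := Hmu k; split=> //.
    (* The two copies of [v] cancel: (w^k - v) - (G'(x^k)^* l^k - v) = mu^k. *)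
    rewrite LE// (_ : _ \- _ = mu k)//; apply/funext => h /=.
    by rewrite E /= opprD opprK addrA subrK addrC addKr.
move=> _ [l [dl nC [_ _ nK]]].
exists l, (\- lagrangian_dx G (\- v) xbar l); split=> //.
by rewrite LE//; apply/funext => h /=; rewrite opprD opprK addrC subrK.
Qed.
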